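(* Let $a,b\geq 1$, $m,p,q>1$ and $n\geq 4$ be integers. The graph $aH_{m,p}\boxtimes bH_{n,q}$ is distance magic if and only if $m\equiv n\equiv 0\pmod 2$ or $mnabpq\equiv 1 \pmod 2$.
   Context: A graph $G$ on $v$ vertices is distance magic if there is a bijection $f:V(G)\to\{1,\ldots,v\}$ and a constant $k$ such that for every vertex $x$, $\sum_{y\in N(x)}f(y)=k$, where $N(x)$ is the set of neighbours of $x$. $H_{n,p}$ denotes the complete multipartite graph with $p$ partite sets each of size $n$; for a positive integer $a$, $aG$ denotes the disjoint union of $a$ copies of $G$. The strong product $G\boxtimes H$ has vertex set $V(G)\times V(H)$, with $(g,h)$ adjacent to $(g',h')$ iff either $g=g'$ and $hh'\in E(H)$, or $h=h'$ and $gg'\in E(G)$, or $gg'\in E(G)$ and $hh'\in E(H)$. *)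

(* Defs.v *)
From mathcomp Require Import all_boot.
Set Implicit Arguments. Unset Strict Implicit. Unset Printing Implicit Defensive.

Definition nbr_sum (T : finType) (e : rel T) (f : T -> nat) (x : T) : nat :=
  \sum_(y | e x y) f y.

Definition distance_magic (T : finType) (e : rel T) : Prop :=
  exists f : T -> nat,
    [/\ injective f,
        (forall x, 1 <= f x <= #|T|) &
        exists k, forall x, nbr_sum e f x = k].

(* H_{n,p}: complete multipartite graph with p parts, each of size n.
   Vertices (i, j) : part i < p, index j < n; adjacent iff different parts. *)
Definition Hvert (n p : nat) : finType := ('I_p * 'I_n)%type.
Definition Hrel (n p : nat) : rel (Hvert n p) :=
  fun u v => u.1 != v.1.

Definition union_rel (a : nat) (T : finType) (e : rel T) : rel ('I_a * T)%type :=
  fun u v => (u.1 == v.1) && e u.2 v.2.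

Definition strong_rel (A B : finType) (eA : rel A) (eB : rel B) : rel (A * B)%type :=
  fun u v =>
    [|| (u.1 == v.1) && eB u.2 v.2,
        (u.2 == v.2) && eA u.1 v.1
      | eA u.1 v.1 && eB u.2 v.2].

Arguments Hrel n p : clear implicits.
Arguments union_rel a {T} e.
Arguments strong_rel {A B} eA eB.

(* Main.v *)
Require Import Defs.
From mathcomp Require Import all_boot all_algebra.
From mathcomp Require Import zify ring.
Set Implicit Arguments. Unset Strict Implicit. Unset Printing Implicit Defensive.
Import GRing.Theory.

(* In a component H_{m,p} [x] H_{n,q} the labels form p * q blocks of size m x n,
   one for each pair of partite sets.  Comparing neighbour sums inside a block
   shows that its lines of either direction have constant sums, and a linear
   system with a unique solution then forces all blocks, in all components, to
   have the same sum.  So the graph is distance magic iff 1, ..., N, where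
   N = mnabpq, can be arranged into abpq rectangles m x n with common line sums
   n(N+1)/2 and m(N+1)/2; integrality of these gives the parity condition.

   Conversely, c magic rectangles are obtained from one m x n magic rectangle B
   as B * c + D_k, where D is an m x n array of permutations of [0, c) whose
   line sums are constant functions.  To build B, centre the labels at 0, so
   that all line sums must vanish, and glue blocks closed under negation: for
   even m, n essentially 2 x 4 blocks with rows +-(x, -(x+d), -(x+2d), x+3d);
   for odd m, n a 3 x 7 core, blocks 3 x 2 and 2 x 3 made of triples
   +-(x, y, -(x+y)), and again 2 x 4 blocks. *)

(** * Zero-sum rectangles *)

Definition entries (T : Type) (A : nat -> nat -> T) (m n : nat) : seq T :=
  [seq A i j | i <- iota 0 m, j <- iota 0 n].

(** Any abelian group is allowed, so that integers and integer-valued functions on ['I_c] are glued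
    by the same lemmas. *)
Definition zero_rect (V : zmodType) (m n : nat) (s : seq V) : Prop :=
  exists A : nat -> nat -> V,
    [/\ perm_eq s (entries A m n),
        forall i, i < m -> (\sum_(0 <= j < n) A i j = 0)%R
      & forall j, j < n -> (\sum_(0 <= i < m) A i j = 0)%R].

Section ZeroRect.
Variable V : zmodType.
Implicit Types (s t v : seq V) (A : nat -> nat -> V).

Lemma zero_rect_perm m n s t : perm_eq s t -> zero_rect m n s -> zero_rect m n t.
Proof.
move=> st [A [sA rA cA]]; exists A; split=> //.
by apply: perm_trans sA; rewrite perm_sym.
Qed.

Lemma zero_rect_tr m n s : zero_rect m n s -> zero_rect n m s.
Proof.
move=> [A [sA rA cA]]; exists (fun i j => A j i); split=> //.
apply: perm_trans sA _; rewrite /entries.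
elim: (iota 0 n) => [|x l IH] /=; first by elim: (iota 0 m).
by rewrite (perm_allpairs_consr _ _ (fun=> x) (fun=> l)) perm_cat2l.
Qed.

Lemma zero_rect_hcat m n1 n2 s1 s2 :
  zero_rect m n1 s1 -> zero_rect m n2 s2 -> zero_rect m (n1 + n2) (s1 ++ s2).
Proof.
move=> [A [sA rA cA]] [B [sB rB cB]].
exists (fun i j => if j < n1 then A i j else B i (j - n1)); split.
- rewrite /entries iotaD add0n perm_sym.
  rewrite (perm_allpairs_catr _ _ (fun=> iota 0 n1) (fun=> iota n1 n2)) perm_sym.
  apply: perm_cat.
  + congr (perm_eq s1 _): sA; rewrite /entries; congr flatten.
    apply: eq_map => i; apply/eq_in_map => j; rewrite mem_iota => /andP[_].
    by rewrite add0n => ->.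
  + congr (perm_eq s2 _): sB; rewrite /entries; congr flatten.
    apply: eq_map => i; rewrite -[X in _ = map _ (iota X _)]addn0 iotaDl -map_comp.
    by apply: eq_map => j /=; rewrite ltnNge leq_addr /= addKn.
- move=> i im; rewrite (@big_cat_nat _ _ _ n1) ?leq_addr //=.
  rewrite -[n1 in X in (_ + X)%R]add0n big_addn addKn.
  rewrite (eq_big_nat _ _ (F2 := A i)) => [|j /andP[_ ->] //].
  rewrite rA // add0r -[RHS](rB i im); apply: eq_bigr => j _.
  by rewrite ltnNge leq_addl /= addnK.
- move=> j jn; case: ltnP => jn1; first exact: cA.
  by apply: cB; lia.
Qed.

Lemma zero_rect_vcat m1 m2 n s1 s2 :
  zero_rect m1 n s1 -> zero_rect m2 n s2 -> zero_rect (m1 + m2) n (s1 ++ s2).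
Proof.
by move=> /zero_rect_tr z1 /zero_rect_tr z2; apply/zero_rect_tr/zero_rect_hcat.
Qed.

Lemma zero_rect0n n : zero_rect 0 n ([::] : seq V).
Proof. by exists (fun _ _ => 0%R); split=> // j _; rewrite big_nil. Qed.

Lemma zero_rectn0 m : zero_rect m 0 ([::] : seq V).
Proof. exact/zero_rect_tr/zero_rect0n. Qed.

Lemma zero_rect_rows2 v :
  (\sum_(x <- v) x = 0)%R -> zero_rect 2 (size v) (v ++ map -%R%R v).
Proof.
move=> v0; exists (fun i j => if i is 0 then nth 0%R v j else (- nth 0 v j)%R).
split.
- rewrite /entries /= cats0 perm_cat //.
    by rewrite -/(mkseq _ _) mkseq_nth.
  by rewrite (map_comp _ (nth 0%R v)) -/(mkseq _ _) mkseq_nth.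
- by move: v0; rewrite (big_nth 0%R) => v0 [|i] _ //; rewrite sumrN v0 oppr0.
- by move=> j _; rewrite !big_nat_recr //= big_nil add0r subrr.
Qed.

Lemma zero_rect_table (t : seq (seq V)) m n :
  size t = m -> (forall r, r \in t -> size r = n) ->
  (forall r, r \in t -> \sum_(x <- r) x = 0)%R ->
  (forall j, j < n -> (\sum_(r <- t) nth 0 r j = 0)%R) ->
  zero_rect m n (flatten t).
Proof.
move=> tm tn rt ct; exists (fun i j => nth 0%R (nth [::] t i) j); split.
- suff <- : flatten t = entries (fun i j => nth 0%R (nth [::] t i) j) m n by [].
  rewrite -[t in LHS](mkseq_nth [::]) tm; congr flatten.
  apply/eq_in_map => i; rewrite mem_iota => /andP[_ im].
  have <- : size (nth [::] t i) = n by rewrite tn // mem_nth // tm.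
  exact/esym/mkseq_nth.
- move=> i im; have it : nth [::] t i \in t by rewrite mem_nth // tm.
  by rewrite -[RHS](rt _ it) [RHS](big_nth 0%R) tn.
- by move=> j jn; rewrite -[RHS](ct j jn) [RHS](big_nth [::]) tm.
Qed.

End ZeroRect.

(** * Magic rectangles from signed sets *)

(** Blocks closed under negation are recorded by absolute values, so gluing them only concatenates
    lists of naturals. *)
Definition sym (s : seq nat) : seq int :=
  map Posz s ++ map (fun x => - Posz x)%R s.

Lemma sym_cat s t : perm_eq (sym (s ++ t)) (sym s ++ sym t).
Proof. by rewrite /sym !map_cat; apply/permP => P; rewrite !count_cat; lia. Qed.

Lemma sym_perm s t : perm_eq s t -> perm_eq (sym s) (sym t).
Proof. by move=> st; rewrite /sym perm_cat ?perm_map. Qed.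

(** The pair [x], [- x] does not depend on the sign of [x]; hence signs may be chosen freely to make
    a row vanish. *)
Lemma sym_absz (l : seq int) :
  perm_eq (l ++ map -%R%R l) (sym (map absz l)).
Proof.
apply/permP => P; rewrite /sym !count_cat !count_map.
elim: l => //= x l IH; suff : P x + P (- x)%R = P (Posz `|x|) + P (- Posz `|x|)%R by lia.
case: x => k; first by rewrite absz_nat.
by rewrite NegzE abszN absz_nat opprK addnC.
Qed.

Lemma zero_rect_cat_sym m n1 n2 s1 s2 :
  zero_rect m n1 (sym s1) -> zero_rect m n2 (sym s2) ->
  zero_rect m (n1 + n2) (sym (s1 ++ s2)).
Proof.
move=> z1 z2; apply: zero_rect_perm (zero_rect_hcat z1 z2).
by rewrite perm_sym sym_cat.
Qed.

Lemma zero_rect_vcat_sym m1 m2 n s1 s2 :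
  zero_rect m1 n (sym s1) -> zero_rect m2 n (sym s2) ->
  zero_rect (m1 + m2) n (sym (s1 ++ s2)).
Proof.
move=> z1 z2; apply: zero_rect_perm (zero_rect_vcat z1 z2).
by rewrite perm_sym sym_cat.
Qed.

Lemma zero_rect_signed (l : seq int) :
  (\sum_(x <- l) x = 0)%R -> zero_rect 2 (size l) (sym (map absz l)).
Proof. by move=> /zero_rect_rows2; apply: zero_rect_perm; apply: sym_absz. Qed.

(** Step 1 serves odd sizes, step 2 even sizes, where the centred labels are odd. *)
Definition progr (d x l : nat) : seq nat := [seq x + d * i | i <- iota 0 l].

Lemma progrD d x k l : progr d x (k + l) = progr d x k ++ progr d (x + d * k) l.
Proof.
rewrite /progr iotaD map_cat add0n; congr (_ ++ _).
rewrite -[X in iota X l]addn0 iotaDl -map_comp; apply: eq_map => i /=; lia.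
Qed.

Lemma progr1 x l : progr 1 x l = iota x l.
Proof. by rewrite -[X in iota X l]addn0 iotaDl; apply: eq_map => i; lia. Qed.

(** Four successive terms cancel under the signs +, -, -, +, and the negated row completes a 2 x 4
    block. *)
Lemma zero_rect_quads d x i j : zero_rect (2 * i) (4 * j) (sym (progr d x (4 * i * j))).
Proof.
have quad y : zero_rect 2 4 (sym (progr d y 4)).
  pose l := [:: Posz y; - Posz (y + d); - Posz (y + d * 2); Posz (y + d * 3)]%R.
  have -> : progr d y 4 = map absz l by rewrite /progr /=; congr [:: _; _; _; _]; lia.
  by apply: (@zero_rect_signed l); rewrite /l !big_cons big_nil; lia.
have row y k : zero_rect 2 (4 * k) (sym (progr d y (4 * k))).
  elim: k y => [|k IH] y; first exact: zero_rectn0.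
  by rewrite mulnS progrD; apply: zero_rect_cat_sym.
elim: i x => [|i IH] x; first by rewrite muln0; exact: zero_rect0n.
have -> : 4 * i.+1 * j = 4 * j + 4 * i * j by lia.
by rewrite mulnS progrD; apply: zero_rect_vcat_sym.
Qed.

(** * Blocks from Schur triples *)

Definition schur (T : seq (nat * nat)) : seq nat :=
  flatten [seq [:: x.1; x.2; x.1 + x.2] | x <- T].

Lemma schur_cat T U : schur (T ++ U) = schur T ++ schur U.
Proof. by rewrite /schur map_cat flatten_cat. Qed.

Lemma zero_rect_schur1 x : zero_rect 2 3 (sym [:: x.1; x.2; x.1 + x.2]).
Proof.
pose l := [:: Posz x.1; Posz x.2; - Posz (x.1 + x.2)]%R.
have -> : [:: x.1; x.2; x.1 + x.2] = map absz l by rewrite /=; congr [:: _; _; _]; lia.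
by apply: (@zero_rect_signed l); rewrite /l !big_cons big_nil; lia.
Qed.

(** Upright blocks, which prolong the 3 x 7 core to the right; the next lemma lays the blocks flat
    to fill the rows below. *)
Lemma zero_rect_schur_top T : zero_rect 3 (2 * size T) (sym (schur T)).
Proof.
elim: T => [|x T IH]; first exact: zero_rectn0.
rewrite mulnS; apply: (@zero_rect_cat_sym 3 2 _ [:: x.1; x.2; x.1 + x.2] (schur T)) => //.
exact/zero_rect_tr/zero_rect_schur1.
Qed.

Lemma zero_rect_schur T i e : size T = i * e -> zero_rect (2 * i) (3 * e) (sym (schur T)).
Proof.
have row U : zero_rect 2 (3 * size U) (sym (schur U)).
  elim: U => [|x U IH]; first exact: zero_rectn0.
  rewrite mulnS; apply: (@zero_rect_cat_sym 2 3 _ [:: x.1; x.2; x.1 + x.2] (schur U)) => //.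
  exact: zero_rect_schur1.
elim: i T => [|i IH] T sT; first by move/size0nil: sT => ->; exact: zero_rect0n.
rewrite mulnS -(cat_take_drop e T) schur_cat; apply: zero_rect_vcat_sym.
  have {1}-> : e = size (take e T) by rewrite size_takel // sT mulSn leq_addr.
  exact: row.
by apply: IH; rewrite size_drop sT mulSn addKn.
Qed.

(* A column (u, v, w) next to the negative of (v, u, w) contributes
   (u - v, v - u, 0) to the row sums; three such pairs compensate the
   column (-t, t, 0). *)
Lemma zero_rect_core (t u1 v1 u2 v2 u3 v3 : int) :
  ((u1 - v1) + (u2 - v2) + (u3 - v3) = t)%R ->
  zero_rect 3 7 (0%R :: sym (map absz
    [:: t; u1; v1; u1 + v1; u2; v2; u2 + v2; u3; v3; u3 + v3]%R)).
Proof.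
move=> ut.
pose tbl := [:: [:: - t; u1; - v1; u2; - v2; u3; - v3];
  [:: t; v1; - u1; v2; - u2; v3; - u3];
  [:: 0; - (u1 + v1); u1 + v1; - (u2 + v2); u2 + v2; - (u3 + v3); u3 + v3]]%R.
apply: (@zero_rect_perm _ _ _ (flatten tbl)).
  rewrite perm_sym; apply: perm_trans (_ : perm_eq _ (0%R :: _)) _.
    by rewrite perm_cons perm_sym; apply: sym_absz.
  by apply/permP => P /=; ring.
apply: zero_rect_table => //.
- by move=> r; rewrite !inE => /or3P[] /eqP ->.
- by move=> r; rewrite !inE => /or3P[] /eqP ->; rewrite !big_cons big_nil; lia.
- by do 7?case=> [_|]; rewrite ?big_cons ?big_nil /=; lia.
Qed.

Lemma schur_map (f g : nat -> nat) s :
  perm_eq (schur [seq (f i, g i) | i <- s])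
          (map f s ++ map g s ++ [seq f i + g i | i <- s]).
Proof.
apply/permP => P; rewrite !count_cat; elim: s => //= i s; rewrite -/(schur _) => ->; lia.
Qed.

Lemma rev_iota_sub x l : [seq x + l - i | i <- iota 1 l] = rev (iota x l).
Proof.
apply: (@eq_from_nth _ 0) => [|i]; rewrite ?size_rev size_map !size_iota // => il.
rewrite nth_rev ?size_iota // (nth_map 0) ?size_iota // !nth_iota //; lia.
Qed.

Lemma odds_evens_iota e g : e = g \/ e = g.+1 ->
  perm_eq ([seq 2 * i - 1 | i <- iota 1 e] ++ [seq 2 * i | i <- iota 1 g])
          (iota 1 (e + g)).
Proof.
move=> eg; apply: uniq_perm; rewrite ?iota_uniq //.
- rewrite cat_uniq; apply/and3P; split.
  + by rewrite map_inj_in_uniq ?iota_uniq // => i j; rewrite !mem_iota; lia.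
  + apply/hasPn => x /mapP[i + ->]; rewrite mem_iota => ig.
    by apply/negP => /mapP[j]; rewrite mem_iota; lia.
  + by rewrite map_inj_uniq ?iota_uniq // => i j; lia.
- move=> x; rewrite mem_cat mem_iota; apply/orP/idP.
    by case=> /mapP[i]; rewrite mem_iota; lia.
  move=> xb; case: (boolP (odd x)) => ox; [left|right];
    apply/mapP; exists (uphalf x); rewrite ?mem_iota; lia.
Qed.

(* The interval [1, 3h+1] is cut into [1, h], an interval of even length 2e and
   one of odd length 2g+1 centred at t, where e + g = h.  Pairing the elements
   of the last two intervals symmetrically about their centres gives the
   differences 1, 3, 5, ... and 2, 4, 6, ..., which exhaust [1, h]; only t is left. *)
Lemma schur_seed_large h : 6 <= h ->
  exists c T, [/\ zero_rect 3 7 (0%R :: sym c), size T = h - 3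
    & perm_eq (c ++ schur T) (iota 1 (3 * h).+1)].
Proof.
move=> h6; pose g := h./2; pose e := h - g; pose t := h + 2 * e + g + 1.
have eg : e = g \/ e = g.+1 by lia.
(* Since [g >= 3], the triples [(2i, t-i, t+i)] with [i <= 3] exist; they enter the core with signs
   for which [(t+3) + (t+6) - (t+9) = t]. *)
pose l := [:: t%:Z; t%:Z + 1; - 2; t%:Z + 1 - 2; t%:Z + 2; - 4; t%:Z + 2 - 4;
  - (t%:Z + 3); 6; - (t%:Z + 3) + 6]%R.
pose T1 := [seq (2 * i - 1, h + e + 1 - i) | i <- iota 1 e].
pose U := [seq (2 * i, t - i) | i <- iota 1 g].
exists (map absz l), (T1 ++ drop 3 U); split.
- by apply: zero_rect_core; lia.
- by rewrite size_cat size_drop !size_map !size_iota; lia.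
have cU : perm_eq (map absz l) (t :: schur (take 3 U)).
  have -> : take 3 U = [:: (2, t - 1); (4, t - 2); (6, t - 3)].
    by rewrite -map_take take_iota (minn_idPl _) //; lia.
  have -> : map absz l = [:: t; t + 1; 2; t - 1; t + 2; 4; t - 2; t + 3; 6; t - 3].
    by rewrite /l /=; congr [:: _; _; _; _; _; _; _; _; _; _]; lia.
  rewrite /schur /=.
  have -> : 2 + (t - 1) = t + 1 by lia.
  have -> : 4 + (t - 2) = t + 2 by lia.
  have -> : 6 + (t - 3) = t + 3 by lia.
  by apply/permP => P /=; ring.
apply: perm_trans (_ : perm_eq _ (t :: schur U ++ schur T1)) _.
  rewrite schur_cat -[U in X in perm_eq _ X](cat_take_drop 3) schur_cat -catA.
  by rewrite -cat_cons perm_cat // perm_catC.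
(* The pieces are [[1, h]], the even interval, and the lower half, centre [t] and upper half of the
   odd interval. *)
have -> : (3 * h).+1 = (e + g) + (2 * e + (g + (1 + g))) by lia.
rewrite iotaD mul2n -addnn !iotaD.
have /permP p1 := odds_evens_iota eg.
have /permP p2 := schur_map (fun i => 2 * i - 1) (fun i => h + e + 1 - i) (iota 1 e).
have /permP p3 := schur_map (fun i => 2 * i) (fun i => t - i) (iota 1 g).
have q1 : [seq h + e + 1 - i | i <- iota 1 e] = rev (iota (h + 1) e).
  by rewrite -rev_iota_sub; apply: eq_map => i; lia.
have q2 : [seq 2 * i - 1 + (h + e + 1 - i) | i <- iota 1 e] = iota (h + e + 1) e.
  by rewrite iotaDl; apply/eq_in_map => i; rewrite mem_iota; lia.
have q3 : [seq t - i | i <- iota 1 g] = rev (iota (h + 2 * e + 1) g).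
  by rewrite -rev_iota_sub; apply: eq_map => i; rewrite /t; lia.
have q4 : [seq 2 * i + (t - i) | i <- iota 1 g] = iota (t + 1) g.
  by rewrite iotaDl; apply/eq_in_map => i; rewrite mem_iota; lia.
apply/permP => P; rewrite /= !count_cat p2 p3 !count_cat q1 q2 q3 q4 !count_rev.
have := p1 P; rewrite iotaD !count_cat.
have -> : 1 + (e + g) = h + 1 by lia.
have -> : h + 1 + e = h + e + 1 by lia.
have -> : h + 1 + (e + e) = h + 2 * e + 1 by lia.
have -> : h + 2 * e + 1 + g = t by rewrite /t; lia.
rewrite /=; lia.
Qed.

(** For [h] = 3, 4, 5 the odd interval yields fewer than three triples, so the core is given
    explicitly. *)
Lemma schur_seed h : 3 <= h ->
  exists c T, [/\ zero_rect 3 7 (0%R :: sym c), size T = h - 3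
    & perm_eq (c ++ schur T) (iota 1 (3 * h).+1)].
Proof.
move=> h3; case: (leqP 6 h) => h6; first exact: schur_seed_large.
have : h \in [:: 3; 4; 5] by rewrite !inE; lia.
rewrite !inE => /or3P[] /eqP ->.
- exists [:: 1; 10; 7; 3; 9; 5; 4; 6; 2; 8], [::]; split=> //.
  exact: (@zero_rect_core 1 (- 10) 7 9 (- 5) 6 2)%R.
- exists [:: 1; 13; 3; 10; 12; 4; 8; 6; 5; 11], [:: (2, 7)]; split=> //.
  exact: (@zero_rect_core 1 13 (- 3) (- 12) 4 6 5)%R.
- exists [:: 2; 16; 3; 13; 15; 4; 11; 8; 6; 14], [:: (5, 7); (1, 9)]; split=> //.
  exact: (@zero_rect_core 2 16 (- 3) (- 15) 4 8 6)%R.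
Qed.

(** * Arrangements of the centred labels *)

(** The labels [0, ..., N - 1] shifted to mean zero and doubled, which keeps them integral for even
    [N]. *)
Definition centered (N : nat) : seq int := [seq (2 * i)%:Z - (N%:Z - 1) | i <- iota 0 N]%R.

Definition double_int : int -> int := fun x => (2 * x)%R.

Lemma zero_rect_double m n s : zero_rect m n s -> zero_rect m n (map double_int s).
Proof.
move=> [A [sA rA cA]]; exists (fun i j => double_int (A i j)); split.
- by rewrite (permPl (perm_map _ sA)) /entries map_allpairs.
- by move=> i im; rewrite -mulr_sumr rA ?mulr0.
- by move=> j jn; rewrite -mulr_sumr cA ?mulr0.
Qed.

Lemma sym_uniq s : uniq s -> 0 \notin s -> uniq (0%R :: sym s).
Proof.
move=> us s0; rewrite cons_uniq mem_cat negb_or cat_uniq.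
rewrite !map_inj_uniq; try by move=> x y; lia.
rewrite us /= andbT; apply/andP; split; last first.
  apply/hasPn => x /mapP[i si ->]; apply/negP => /mapP[j sj ij].
  have i0 : i = 0 by lia.
  by move: s0; rewrite -i0 si.
apply/andP; split; apply/mapP => -[i si i0]; have iz : i = 0 by lia.
  by move: s0; rewrite -iz si.
by move: s0; rewrite -iz si.
Qed.

(** For an odd number of labels all centred values are even, so arranging [[-L, L]] and doubling
    suffices. *)
Lemma centered_odd L :
  perm_eq (map double_int (0%R :: sym (iota 1 L))) (centered L.*2.+1).
Proof.
have inj : injective double_int by rewrite /double_int => x y; lia.
apply: uniq_perm.
- by rewrite map_inj_uniq // sym_uniq ?iota_uniq // mem_iota.
- by rewrite map_inj_uniq ?iota_uniq // => x y; lia.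
- move=> x; apply/mapP/mapP.
  + move=> [y + ->]; rewrite inE mem_cat => /orP[/eqP->|/orP[]/mapP[i +]].
    * by exists L; rewrite ?mem_iota /double_int; lia.
    * by rewrite mem_iota => il ->; exists (L + i); rewrite ?mem_iota /double_int; lia.
    * by rewrite mem_iota => il ->; exists (L - i); rewrite ?mem_iota /double_int; lia.
  + move=> [i]; rewrite mem_iota => il ->; exists (i%:Z - L%:Z)%R; last by rewrite /double_int; lia.
    rewrite inE mem_cat; case: (ltngtP i L) => iL.
    * apply/or3P; apply: Or33; apply/mapP; exists (L - i); rewrite ?mem_iota; lia.
    * apply/or3P; apply: Or32; apply/mapP; exists (i - L); rewrite ?mem_iota; lia.
    * by rewrite iL subrr.
Qed.

Lemma centered_even L : perm_eq (sym (progr 2 1 L)) (centered L.*2).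
Proof.
apply: uniq_perm.
- suff /andP[] : uniq (0%R :: sym (progr 2 1 L)) by [].
  rewrite sym_uniq //; first by rewrite map_inj_uniq ?iota_uniq // => x y; lia.
  by apply/mapP => -[i _]; lia.
- by rewrite map_inj_uniq ?iota_uniq // => x y; lia.
- move=> x; rewrite mem_cat; apply/orP/mapP.
  + case=> /mapP[y /mapP[i]]; rewrite mem_iota => il -> ->.
    * by exists (L + i); rewrite ?mem_iota; lia.
    * by exists (L - i.+1); rewrite ?mem_iota; lia.
  + move=> [i]; rewrite mem_iota => il ->; case: (ltnP i L) => iL; [right|left].
    * apply/mapP; exists (1 + 2 * (L - i.+1)); last by lia.
      by apply: map_f; rewrite mem_iota; lia.
    * apply/mapP; exists (1 + 2 * (i - L)); last by lia.
      by apply: map_f; rewrite mem_iota; lia.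
Qed.

(** The first three rows hold the core and [k] blocks 3 x 2. The [2 * i] rows below hold [3 * e]
    columns of 2 x 3 blocks and [4 * j] columns of 2 x 4 blocks. The latter use the absolute values
    above [3 * h + 1]. *)
Lemma zero_rect_odd_wide m n : odd m -> odd n -> 3 <= m -> 7 <= n ->
  zero_rect m n (centered (m * n)).
Proof.
move=> om on m3 n7; pose i := (m - 3)./2; pose k := (n - 7)./2.
(* Modulo 4 one of 3 and 9 agrees with [n]; the choice [e = 3] needs [n >= 9], which holds as then
   [n] is 1 modulo 4 and at least 7. *)
have [e [j nE]] : exists e j, n = 3 * e + 4 * j.
  case: (boolP (n %% 4 == 3)) => n4; [exists 1, (n %/ 4)|exists 3, (n %/ 4 - 2)]; lia.
(* Three triples go into the core, [k] beside it and [i * e] below. *)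
have [h hE] : exists h, h = 3 + k + i * e by exists (3 + k + i * e).
have [|c [T [cz sT pT]]] := @schur_seed h; first by lia.
have mE : m = 3 + 2 * i by lia.
have mnE : m * n = (3 * h + 1 + 4 * i * j).*2.+1.
  have -> : m * n = 3 * n + 2 * (3 * (i * e) + 4 * (i * j)).
    by rewrite mE mulnDl nE; ring.
  by rewrite -mulnA; lia.
rewrite mnE; apply: zero_rect_perm (centered_odd _) _; apply: zero_rect_double.
pose T1 := take k T; pose T2 := drop k T.
have sT1 : size T1 = k by rewrite size_takel ?sT //; lia.
have sT2 : size T2 = i * e by rewrite size_drop sT; lia.
have top : zero_rect 3 n (0%R :: sym (c ++ schur T1)).
  have -> : n = 7 + 2 * size T1 by lia.
  apply: zero_rect_perm (zero_rect_hcat cz (zero_rect_schur_top T1)).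
  by rewrite /= perm_cons perm_sym sym_cat.
have bot : zero_rect (2 * i) n (sym (schur T2 ++ progr 1 (3 * h).+2 (4 * i * j))).
  rewrite nE; apply: zero_rect_cat_sym; last exact: zero_rect_quads.
  exact: zero_rect_schur.
rewrite mE.
apply: zero_rect_perm (zero_rect_vcat top bot).
rewrite /= perm_cons -(permPl (sym_cat _ _)); apply: sym_perm.
rewrite progr1 addn1 iotaD add1n catA perm_cat2r -catA -schur_cat.
by rewrite cat_take_drop.
Qed.

(** Up to transposition the general layout leaves only 3 x 5 and 5 x 5, given by tables on [[-7, 7]]
    and [[-12, 12]]. *)
Lemma zero_rect_odd m n : odd m -> odd n -> 3 <= m -> 5 <= n ->
  zero_rect m n (centered (m * n)).
Proof.
move=> om on m3 n5; case: (leqP 7 n) => n7; first exact: zero_rect_odd_wide.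
have -> : n = 5 by lia.
case: (leqP 7 m) => m7.
  by apply: zero_rect_tr; rewrite mulnC; apply: zero_rect_odd_wide.
have : m \in [:: 3; 5] by rewrite !inE; lia.
rewrite !inE => /orP[] /eqP ->.
- pose t := [:: [:: -7; 3; -3; 1; 6]; [:: 2; -2; -4; 4; 0];
                [:: 5; -1; 7; -5; -6]]%R : seq (seq int).
  apply: zero_rect_perm (centered_odd 7) _; apply: zero_rect_double.
  apply: (@zero_rect_perm _ _ _ (flatten t)); first by vm_compute.
  apply: zero_rect_table => //.
  + by move=> r; rewrite !inE => /or3P[] /eqP ->.
  + by move=> r; rewrite !inE => /or3P[] /eqP ->; rewrite !big_cons big_nil.
  + by do 5?case=> [_|//]; rewrite !big_cons big_nil.
- pose t := [:: [:: -7; 4; 6; -8; 5]; [:: 9; 10; -10; 0; -9];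
    [:: 12; -12; -6; 11; -5]; [:: -3; -4; 7; -1; 1]; [:: -11; 2; 3; -2; 8]]%R : seq (seq int).
  apply: zero_rect_perm (centered_odd 12) _; apply: zero_rect_double.
  apply: (@zero_rect_perm _ _ _ (flatten t)); first by vm_compute.
  apply: zero_rect_table => //.
  + by move=> r; rewrite !inE; do !case/orP; move=> /eqP ->.
  + by move=> r; rewrite !inE; do !case/orP; move=> /eqP ->; rewrite !big_cons big_nil.
  + by do 5?case=> [_|//]; rewrite !big_cons big_nil.
Qed.

(** Blocks 2 x 4 or 4 x 2 suffice when 4 divides a side. Otherwise a 2 x 6 block opens the top two
    rows; the rest of these rows and the [4 * i] rows below are again cut into such blocks. *)
Lemma zero_rect_even m n : ~~ odd m -> ~~ odd n -> 4 <= n ->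
  zero_rect m n (centered (m * n)).
Proof.
move=> em en n4.
have half L : m * n = 2 * L -> zero_rect m n (sym (progr 2 1 L)) ->
    zero_rect m n (centered (m * n)).
  by rewrite mul2n => -> z; apply: zero_rect_perm (centered_even _) z.
have mE : m = 2 * m./2 by lia.
have nE : n = 2 * n./2 by lia.
case: (boolP (4 %| n)) => [n4d|n4d].
  have n4E : n = 4 * (n %/ 4) by lia.
  apply: (half (4 * m./2 * (n %/ 4))); first by rewrite {1}mE {1}n4E; ring.
  by rewrite {1}mE {1}n4E; apply: zero_rect_quads.
case: (boolP (4 %| m)) => [m4d|m4d].
  have m4E : m = 4 * (m %/ 4) by lia.
  apply: (half (4 * n./2 * (m %/ 4))); first by rewrite {1}m4E {1}nE; ring.
  by apply: zero_rect_tr; rewrite {1}nE {1}m4E; apply: zero_rect_quads.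
have [i m4E] : exists i, m = 2 + 4 * i by exists (m %/ 4); lia.
have [j n4E] : exists j, n = 6 + 4 * j by exists (n %/ 4 - 1); lia.
apply: (half (6 + 4 * 1 * j + 4 * n./2 * i)).
  by rewrite m4E mulnDl {1}n4E {1}nE; ring.
have s6 : zero_rect 2 6 (sym (progr 2 1 6)).
  by apply: (@zero_rect_signed [:: 1; 3; 5; -7; 9; -11]%R); rewrite !big_cons big_nil.
rewrite 2!progrD m4E; apply: zero_rect_vcat_sym.
  rewrite n4E; apply: zero_rect_cat_sym => //; exact: (zero_rect_quads 2 _ 1 j).
by apply: zero_rect_tr; rewrite {1}nE; apply: zero_rect_quads.
Qed.

Lemma centeredP N (x : int) :
  reflect (exists2 i, i < N & x = ((2 * i)%:Z - (N%:Z - 1))%R) (x \in centered N).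
Proof.
apply: (iffP mapP) => -[i]; first by rewrite mem_iota => iN ->; exists i.
by move=> iN ->; exists i; rewrite ?mem_iota.
Qed.

Lemma centered_uniq N : uniq (centered N).
Proof. by rewrite map_inj_uniq ?iota_uniq // => x y; lia. Qed.

Lemma uniq_map_inj (T U : eqType) (f : T -> U) (s : seq T) :
  uniq (map f s) -> {in s &, injective f}.
Proof.
elim: s => //= x s IH /andP[xs us] y z; rewrite !inE.
case/predU1P=> [->|ys]; case/predU1P=> [->|zs] // fyz.
- by move: xs; rewrite fyz map_f.
- by move: xs; rewrite -fyz map_f.
- exact: IH.
Qed.

Lemma entries_inj (T : eqType) (A : nat -> nat -> T) m n i j i' j' :
  uniq (entries A m n) -> i < m -> j < n -> i' < m -> j' < n ->
  A i j = A i' j' -> (i, j) = (i', j').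
Proof.
have -> : entries A m n
    = [seq A x.1 x.2 | x <- [seq (i, j) | i <- iota 0 m, j <- iota 0 n]].
  by rewrite map_allpairs.
move=> /uniq_map_inj inj im jn im' jn' Aij.
by apply: inj => //; apply/allpairsP; [exists (i, j)|exists (i', j')];
  rewrite !mem_iota.
Qed.

(** * Sets of magic rectangles *)

Section CenteredPerm.
Variable c : nat.
Implicit Types g : {ffun 'I_c -> int}.

(** Such [g] are the permutations of [[0, c)] after centring, which turns reversal of values into
    negation. *)
Definition cperm g : bool := injectiveb g && [forall k, g k \in centered c].

Lemma cperm_opp g : cperm g -> cperm (- g)%R.
Proof.
move=> /andP[/injectiveP gi /forallP gc]; apply/andP; split.
  by apply/injectiveP => k l; rewrite !ffunE => /oppr_inj /gi.
apply/forallP => k; have /centeredP[i ic gk] := gc k.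
by apply/centeredP; exists (c - i.+1); rewrite ?ffunE ?gk; lia.
Qed.

Lemma cperm_ffun (f : nat -> nat) :
  (forall k, k < c -> f k < c) ->
  (forall k l, k < c -> l < c -> f k = f l -> k = l) ->
  cperm [ffun k : 'I_c => ((2 * f k)%:Z - (c%:Z - 1))%R].
Proof.
move=> fc fi; apply/andP; split.
  apply/injectiveP => k l; rewrite !ffunE => kl; apply: ord_inj; apply: fi => //; lia.
by apply/forallP => k; rewrite ffunE; apply/centeredP; exists (f k) => //; apply: fc.
Qed.

(** A line sum that vanishes as a function vanishes at all [c] indices at once. Different cells may
    hold the same permutation. *)
Definition cperm_rect m n : Prop :=
  exists2 s : seq {ffun 'I_c -> int}, zero_rect m n s & all cperm s.

Lemma cperm_rect_tr m n : cperm_rect m n -> cperm_rect n m.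
Proof. by move=> [s z cs]; exists s => //; apply: zero_rect_tr. Qed.

Lemma cperm_rect_hcat m n1 n2 :
  cperm_rect m n1 -> cperm_rect m n2 -> cperm_rect m (n1 + n2).
Proof.
move=> [s z cs] [t y ct]; exists (s ++ t); first exact: zero_rect_hcat.
by rewrite all_cat cs.
Qed.

Lemma cperm_rect_hrep m n k : cperm_rect m n -> cperm_rect m (n * k).
Proof.
move=> mn; elim: k => [|k IH]; last by rewrite mulnS; apply: cperm_rect_hcat.
by rewrite muln0; exists [::] => //; exact: zero_rectn0.
Qed.

Lemma cperm_rect_vrep m n k : cperm_rect m n -> cperm_rect (m * k) n.
Proof. by move=> /cperm_rect_tr mn; apply/cperm_rect_tr/cperm_rect_hrep. Qed.

Lemma cperm_rect_rows2 v :
  all cperm v -> (\sum_(x <- v) x = 0)%R -> cperm_rect 2 (size v).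
Proof.
move=> cv v0; exists (v ++ map -%R%R v); first exact: zero_rect_rows2.
rewrite all_cat cv all_map /=; apply/allP => g gv; exact/cperm_opp/(allP cv).
Qed.

Lemma cperm_rect22 : cperm_rect 2 2.
Proof.
pose g := [ffun k : 'I_c => ((2 * k)%:Z - (c%:Z - 1))%R].
have cg : cperm g by apply: (@cperm_ffun id).
apply: (@cperm_rect_rows2 [:: g; - g]%R); first by rewrite /= cg cperm_opp.
by rewrite !big_cons big_nil addr0 subrr.
Qed.

Lemma cperm_rect_even m n : ~~ odd m -> ~~ odd n -> cperm_rect m n.
Proof.
move=> em en; have -> : m = 2 * m./2 by lia.
have -> : n = 2 * n./2 by lia.
exact/cperm_rect_hrep/cperm_rect_vrep/cperm_rect22.
Qed.

(* The rows of a Kotzig array: three permutations of [0, c) whose pointwise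
   sum is constant, which requires c to be odd. *)
Lemma cperm_triple : odd c ->
  exists a b d, [/\ cperm a, cperm b, cperm d & (a + b + d = 0)%R].
Proof.
move=> oc; pose h := c./2.
(* The sum [k + b k] takes each value in [[h, 3h]] once, so [3 * h - k - b k] is again a permutation
   of [[0, 2h]]. *)
pose b k := if odd k then 2 * h - k./2 else h - k./2.
exists [ffun k : 'I_c => ((2 * k)%:Z - (c%:Z - 1))%R].
exists [ffun k : 'I_c => ((2 * b k)%:Z - (c%:Z - 1))%R].
exists [ffun k : 'I_c => ((2 * (3 * h - k - b k)%N)%:Z - (c%:Z - 1))%R].
split.
- exact: (@cperm_ffun id).
- by apply: cperm_ffun; rewrite /b => k; [case: ifP; lia|move=> l; do 2!case: ifP; lia].
- apply: (@cperm_ffun (fun k => 3 * h - k - b k)); rewrite /b => k.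
    by case: ifP; lia.
  by move=> l; do 2!case: ifP; lia.
- apply/ffunP => k; rewrite !ffunE /b; have := ltn_ord k.
  by case: ifP; lia.
Qed.

(** A 3 x 3 corner, the cyclic Latin square on the triple, is extended by 2 x 3, 3 x 2 and 2 x 2
    blocks. *)
Lemma cperm_rect_odd m n :
  odd c -> odd m -> odd n -> 3 <= m -> 3 <= n -> cperm_rect m n.
Proof.
move=> /cperm_triple[a [b [d [ca cb cd abd]]]] om on m3 n3.
have r23 : cperm_rect 2 3.
  apply: (@cperm_rect_rows2 [:: a; b; d]); first by rewrite /= ca cb cd.
  by rewrite !big_cons big_nil addr0 addrA.
have r33 : cperm_rect 3 3.
  pose t := [:: [:: a; b; d]; [:: b; d; a]; [:: d; a; b]].
  have abd1 : (b + (d + a) = 0)%R by rewrite addrA addrC addrA.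
  have abd2 : (d + (a + b) = 0)%R by rewrite addrC.
  exists (flatten t); last by rewrite /= ca cb cd.
  apply: zero_rect_table => //.
  - by move=> r; rewrite !inE => /or3P[] /eqP ->.
  - by move=> r; rewrite !inE => /or3P[] /eqP ->; rewrite !big_cons big_nil addr0 // addrA.
  - by case=> [|[|[|j]]] // _; rewrite !big_cons big_nil addr0 //= addrA.
have -> : n = 3 + 2 * (n - 3)./2 by lia.
apply: cperm_rect_hcat; apply: cperm_rect_tr; have -> : m = 3 + 2 * (m - 3)./2 by lia.
  by apply: cperm_rect_hcat => //; apply/cperm_rect_hrep/cperm_rect_tr.
by apply: cperm_rect_hcat; [exact: cperm_rect_vrep|apply: cperm_rect_even; lia].
Qed.

End CenteredPerm.

(** In copy [k] the quotient of a label by [c] comes from [A] and the remainder from the permutation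
    in the same cell of [D]. Labels start at 0 here. *)
Lemma magic_rect_set m n c :
  zero_rect m n (centered (m * n)) -> cperm_rect c m n ->
  exists F : 'I_c -> 'I_m -> 'I_n -> nat,
  [/\ forall k i j k' i' j', F k i j = F k' i' j' -> [/\ k = k', i = i' & j = j'],
      forall k i j, F k i j < m * n * c,
      forall k i, 2 * \sum_j F k i j = n * (m * n * c - 1)
    & forall k j, 2 * \sum_i F k i j = m * (m * n * c - 1)].
Proof.
move=> [A [sA rA cA]] [s [D [sD rD cD]] ps].
have uA : uniq (entries A m n) by rewrite -(perm_uniq sA) centered_uniq.
have inA (i : 'I_m) (j : 'I_n) : A i j \in centered (m * n).
  by rewrite (perm_mem sA); apply/allpairsP; exists (val i, val j); rewrite !mem_iota /=.
have inD (i : 'I_m) (j : 'I_n) : cperm (D i j).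
  apply: (allP ps); rewrite (perm_mem sD); apply/allpairsP.
  by exists (val i, val j); rewrite !mem_iota /=.
(* Inverts the centring, sending [2 * i - (N - 1)] back to [i]. *)
pose half N (x : int) := absz (x + (N%:Z - 1))%R %/ 2.
have halfP N x : x \in centered N -> (half N x < N) /\ Posz (half N x).*2 = (x + (N%:Z - 1))%R.
  by case/centeredP => i iN ->; rewrite /half; lia.
pose F k (i : 'I_m) (j : 'I_n) := half (m * n) (A i j) * c + half c (D i j k).
have hA i j := halfP _ _ (inA i j).
have hD (i : 'I_m) (j : 'I_n) k : (half c (D i j k) < c) /\
    Posz (half c (D i j k)).*2 = (D i j k + (c%:Z - 1))%R.
  by have /andP[_ /forallP/(_ k)] := inD i j; apply: halfP.
(* Doubling makes the centred arrays enter linearly, so along a line only the constant term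
   survives. *)
have FE k (i : 'I_m) (j : 'I_n) :
    Posz (2 * F k i j) = (A i j * c%:Z + D i j k + (m * n * c - 1)%N%:Z)%R.
  have [_ a2] := hA i j; have [dc d2] := hD i j k.
  have [alt _] := hA i j.
  have -> : Posz (m * n * c - 1) = ((m * n)%:Z * c%:Z - 1)%R.
    have mnc : 0 < m * n * c by rewrite muln_gt0 (leq_ltn_trans _ alt) ?(leq_ltn_trans _ dc).
    by rewrite -PoszM -subzn.
  rewrite /F mulnDr PoszD mulnA PoszM !mul2n a2 d2; ring.
exists F; split.
- move=> k i j k' i' j' FF.
  have [_ a2] := hA i j; have [dc d2] := hD i j k.
  have [_ a2'] := hA i' j'; have [dc' d2'] := hD i' j' k'.
  have aa : half (m * n) (A i j) = half (m * n) (A i' j').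
    have := congr1 (divn^~ c) FF.
    by rewrite /F !divnMDl ?(leq_ltn_trans _ dc) // !divn_small // !addn0.
  have dd : half c (D i j k) = half c (D i' j' k') by move: FF; rewrite /F aa; lia.
  have Aij : A i j = A i' j' by lia.
  have [ii jj] := entries_inj uA (ltn_ord i) (ltn_ord j) (ltn_ord i') (ltn_ord j') Aij.
  have {ii}ii := ord_inj ii; have {jj}jj := ord_inj jj; subst i' j'; split=> //.
  by have /andP[/injectiveP Di _] := inD i j; apply: Di; apply: (addIr (c%:Z - 1)%R); rewrite -d2 -d2' dd.
- move=> k i j; rewrite /F; have [alt _] := hA i j; have [dlt _] := hD i j k.
  by apply: leq_trans (_ : (half (m * n) (A i j)).+1 * c <= _);
    rewrite ?leq_mul2r ?alt ?orbT // mulSn addnC ltn_add2r.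
- move=> k i; apply/eqP; rewrite -eqz_nat big_distrr /= (big_morph Posz PoszD (erefl _)).
  under eq_bigr do rewrite FE.
  rewrite !big_split /= -mulr_suml sumr_const card_ord.
  have := rA i (ltn_ord i); rewrite big_mkord => ->.
  have := rD i (ltn_ord i); rewrite big_mkord => /ffunP/(_ k); rewrite sum_ffunE ffunE => ->.
  by rewrite mul0r !add0r -mulr_natl natz PoszM.
- move=> k j; apply/eqP; rewrite -eqz_nat big_distrr /= (big_morph Posz PoszD (erefl _)).
  under eq_bigr do rewrite FE.
  rewrite !big_split /= -mulr_suml sumr_const card_ord.
  have := cA j (ltn_ord j); rewrite big_mkord => ->.
  have := cD j (ltn_ord j); rewrite big_mkord => /ffunP/(_ k); rewrite sum_ffunE ffunE => ->.
  by rewrite mul0r !add0r -mulr_natl natz PoszM.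
Qed.

(** * Neighbour sums in the strong product *)

(** Irreflexivity makes the three kinds of adjacency mutually exclusive, so the sum splits. *)
Lemma nbr_sum_strong (A B : finType) (eA : rel A) (eB : rel B) f u v :
  irreflexive eA -> irreflexive eB ->
  nbr_sum (strong_rel eA eB) f (u, v) =
    nbr_sum eB (fun v' => f (u, v')) v + nbr_sum eA (fun u' => f (u', v)) u
    + nbr_sum eA (fun u' => nbr_sum eB (fun v' => f (u', v')) v) u.
Proof.
move=> irrA irrB; rewrite /nbr_sum.
transitivity (\sum_(y | (y.1 == u) && eB v y.2) f (y.1, y.2) +
   \sum_(y | eA u y.1 && (y.2 == v)) f (y.1, y.2) +
   \sum_(y | eA u y.1 && eB v y.2) f (y.1, y.2)).
  rewrite [LHS]big_mkcond [X in _ = X + _ + _]big_mkcond [X in _ = _ + X + _]big_mkcond.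
  rewrite [X in _ = _ + X]big_mkcond -!big_split /=; apply: eq_bigr => -[u' v'] _.
  rewrite /strong_rel /=; case: (eqVneq u u') => [<-|_]; rewrite ?irrA ?andbF /=.
    by rewrite orbF !addn0.
  by case: (eqVneq v v') => [<-|_]; rewrite ?irrB ?andbT ?andbF ?orbF /= ?addn0.
rewrite -(pair_big (fun x => x == u) (eB v) (fun x y => f (x, y))) big_pred1_eq.
rewrite -(pair_big (eA u) (fun x => x == v) (fun x y => f (x, y))).
rewrite -(pair_big (eA u) (eB v) (fun x y => f (x, y))) /=.
by congr (_ + _ + _); apply: eq_bigr => x _; rewrite big_pred1_eq.
Qed.

Lemma nbr_sum_union_multipartite a m p (f : 'I_a * Hvert m p -> nat) c i s :
  nbr_sum (union_rel a (Hrel m p)) f (c, (i, s)) =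
  \sum_(i' | i' != i) \sum_s' f (c, (i', s')).
Proof.
rewrite /nbr_sum /union_rel /Hrel /=.
transitivity (\sum_(y | (y.1 == c) && (i != y.2.1)) f (y.1, y.2)).
  by apply: eq_big => [y|[] //]; rewrite eq_sym.
rewrite -(pair_big (fun x => x == c) (fun y : Hvert m p => i != y.1) (fun x y => f (x, y))).
rewrite big_pred1_eq pair_big /=; apply: eq_big => [[i' s']|[] //].
by rewrite /= eq_sym andbT.
Qed.

Lemma nbr_sum_multipartite_product a b m p q n
    (f : ('I_a * Hvert m p) * ('I_b * Hvert n q) -> nat) c i s d j t :
  nbr_sum (strong_rel (union_rel a (Hrel m p)) (union_rel b (Hrel n q))) f
    ((c, (i, s)), (d, (j, t))) =
  \sum_(j' | j' != j) \sum_t' f ((c, (i, s)), (d, (j', t')))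
  + \sum_(i' | i' != i) \sum_s' f ((c, (i', s')), (d, (j, t)))
  + \sum_(i' | i' != i) \sum_s' \sum_(j' | j' != j) \sum_t'
      f ((c, (i', s')), (d, (j', t'))).
Proof.
have irr k x y : irreflexive (union_rel k (Hrel x y)).
  by move=> u; rewrite /union_rel /Hrel !eqxx.
rewrite (nbr_sum_strong _ _ _ (irr _ _ _) (irr _ _ _)).
rewrite !nbr_sum_union_multipartite; congr (_ + _).
apply: eq_bigr => i' _; apply: eq_bigr => s' _.
exact: nbr_sum_union_multipartite.
Qed.

(** * Necessity *)

Lemma sum_int_const (u : nat) (y : int) : (\sum_(v < u) y = u%:Z * y)%R.
Proof. by rewrite sumr_const card_ord -mulr_natl natz. Qed.

Lemma sum_neq (q : nat) (x : 'I_q -> int) j :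
  (\sum_(j' | j' != j) x j' = \sum_j' x j' - x j)%R.
Proof. by rewrite [X in (_ = X - _)%R](bigD1 j) //= addrAC subrr add0r. Qed.

(** Each [x j] equals the total [X], whence [q * X = X]. *)
Lemma sum_neq_eq0 (q : nat) (x : 'I_q -> int) : 1 < q ->
  (forall j, \sum_(j' | j' != j) x j' = 0)%R -> forall j, (x j = 0)%R.
Proof.
move=> q1 x0; have xE j : x j = (\sum_j' x j')%R.
  by apply/esym/eqP; rewrite -subr_eq0 -sum_neq x0.
suff X0 : (\sum_j' x j' = 0)%R by move=> j; rewrite xE.
move: xE; set X := (\sum_j' x j')%R => xE.
have /eqP : (X *+ q.-1 = 0)%R.
  apply: (addrI X); rewrite -mulrS prednK ?(ltnW q1) // addr0.
  by rewrite {2}/X (eq_bigr (fun=> X)) // sumr_const card_ord.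
by rewrite -mulr_natl natz mulf_eq0 eqz_nat => /orP[|/eqP //]; lia.
Qed.

(** Inclusion-exclusion expresses [x i j] through its row sum, its column sum and the total. Summing
    this relation shows that the total vanishes, then the row and column sums, then [x i j]. *)
Lemma block_system_eq0 (p q m n : nat) (x : 'I_p -> 'I_q -> int) :
  1 < p -> 1 < q -> 1 < m -> 2 < n ->
  (forall i j, n%:Z * (\sum_(j' | j' != j) x i j') +
    m%:Z * (\sum_(i' | i' != i) x i' j) +
    m%:Z * n%:Z * (\sum_(i' | i' != i) \sum_(j' | j' != j) x i' j') = 0)%R ->
  forall i j, (x i j = 0)%R.
Proof.
move=> p1 q1 m1 n2 H.
pose X i := (\sum_j x i j)%R; pose Y j := (\sum_i x i j)%R; pose T := (\sum_i X i)%R.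
have TE : (\sum_j Y j = T)%R by rewrite /T /X exchange_big.
pose g := (m%:Z * n%:Z - m%:Z - n%:Z)%R.
have E i j : (x i j * g = n%:Z * (m%:Z - 1) * X i + m%:Z * (n%:Z - 1) * Y j
    - m%:Z * n%:Z * T)%R.
  have D : (\sum_(i' | i' != i) \sum_(j' | j' != j) x i' j' = T - X i - (Y j - x i j))%R.
    rewrite (eq_bigr (fun i' => X i' - x i' j)%R) => [|i' _]; last exact: sum_neq.
    by rewrite sumrB !sum_neq.
  have := H i j; rewrite D !sum_neq -/(X i) -/(Y j) => E.
  by apply/eqP; rewrite -subr_eq0 -[X in _ == X]E /g; apply/eqP; ring.
have EX i : (X i * (g - q%:Z * (n%:Z * (m%:Z - 1))) =
    (m%:Z * (n%:Z - 1) - q%:Z * (m%:Z * n%:Z)) * T)%R.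
  have : (X i * g = \sum_j x i j * g)%R by rewrite mulr_suml.
  rewrite (eq_bigr _ (fun j _ => E i j)) !big_split /= -[X in (_ + X + _)%R]mulr_sumr TE.
  by rewrite !sum_int_const => XE; rewrite mulrBr XE; ring.
have EY j : (Y j * (g - p%:Z * (m%:Z * (n%:Z - 1))) =
    (n%:Z * (m%:Z - 1) - p%:Z * (m%:Z * n%:Z)) * T)%R.
  have : (Y j * g = \sum_i x i j * g)%R by rewrite mulr_suml.
  rewrite (eq_bigr _ (fun i _ => E i j)) !big_split /= -[X in (X + _ + _)%R]mulr_sumr -/T.
  by rewrite !sum_int_const => YE; rewrite mulrBr YE; ring.
(* After these shifts every decisive coefficient is a natural number that is visibly positive. *)
have [p' pE] : exists p', p = p' + 2 by exists (p - 2); lia.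
have [q' qE] : exists q', q = q' + 2 by exists (q - 2); lia.
have [m' mE] : exists m', m = m' + 2 by exists (m - 2); lia.
have [n' nE] : exists n', n = n' + 3 by exists (n - 3); lia.
have T0 : T = 0%R.
  have TT : (T * (g - q%:Z * (n%:Z * (m%:Z - 1))) =
      p%:Z * ((m%:Z * (n%:Z - 1) - q%:Z * (m%:Z * n%:Z)) * T))%R.
    rewrite {1}/T mulr_suml (eq_bigr _ (fun i _ => EX i)).
    by rewrite sum_int_const.
  (* The factor is the weight [n(q-1) + m(p-1) + mn(p-1)(q-1)]. *)
  have /eqP : (T * Posz (n * (q' + 1) + m * (p' + 1) + m * n * (p' + 1) * (q' + 1)) = 0)%R.
    move/eqP: TT; rewrite -subr_eq0 => /eqP TT; rewrite -[RHS]TT /g pE qE.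
    by rewrite !(PoszD, PoszM); ring.
  by rewrite mulf_eq0 => /orP[/eqP //|]; rewrite eqz_nat nE; lia.
have X0 i : X i = 0%R.
  have : (X i * Posz (m + (q' + 1) * n * (m' + 1)) = 0)%R.
    have := EX i; rewrite T0 mulr0 => XE; apply: oppr_inj; rewrite oppr0 -[RHS]XE.
    by rewrite /g qE mE !(PoszD, PoszM); ring.
  by move/eqP; rewrite mulf_eq0 => /orP[/eqP //|]; rewrite eqz_nat mE; lia.
have Y0 j : Y j = 0%R.
  have : (Y j * Posz (n + (p' + 1) * m * (n' + 2)) = 0)%R.
    have := EY j; rewrite T0 mulr0 => YE; apply: oppr_inj; rewrite oppr0 -[RHS]YE.
    by rewrite /g pE nE !(PoszD, PoszM); ring.
  by move/eqP; rewrite mulf_eq0 => /orP[/eqP //|]; rewrite eqz_nat nE; lia.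
move=> i j; have /eqP := E i j; rewrite X0 Y0 T0 !mulr0 subr0 addr0 mulf_eq0.
case/orP=> /eqP //.
(* This is [(m - 1)(n - 1) - 1], positive because [n > 2]; for [m = n = 2] it would vanish. *)
have -> : g = Posz (m' * n' + 2 * m' + n' + 1).
  by rewrite /g mE nE !(PoszD, PoszM); ring.
by move/eqP; rewrite eqz_nat; lia.
Qed.

(* If all blocks have sum S, then mn times the neighbour sum is S * block_weight. *)
Definition block_weight (p q m n : nat) : nat :=
  n * (q - 1) + m * (p - 1) + m * n * ((p - 1) * (q - 1)).

Lemma line_sums_const (p q m n k : nat) (G : 'I_p -> 'I_m -> 'I_q -> 'I_n -> nat) :
  1 < p -> 1 < q -> 1 < m -> 2 < n ->
  (forall i s j t, \sum_(j' | j' != j) \sum_t' G i s j' t'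
    + \sum_(i' | i' != i) \sum_s' G i' s' j t
    + \sum_(i' | i' != i) \sum_s' \sum_(j' | j' != j) \sum_t' G i' s' j' t' = k) ->
  (forall i s j, (\sum_t G i s j t) * block_weight p q m n = n * k) /\
  (forall i j t, (\sum_s G i s j t) * block_weight p q m n = m * k).
Proof.
move=> p1 q1 m1 n2 H.
pose r i s j := Posz (\sum_t G i s j t); pose l i j t := Posz (\sum_s G i s j t).
pose S i j := (\sum_s r i s j)%R.
have SE i j : S i j = (\sum_t l i j t)%R.
  rewrite /S /r /l -!(big_morph Posz PoszD (erefl _)) exchange_big //.
have HZ i s j t : (\sum_(j' | j' != j) r i s j' + \sum_(i' | i' != i) l i' j t
    + \sum_(i' | i' != i) \sum_(j' | j' != j) S i' j' = k%:Z)%R.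
  rewrite -(H i s j t) !PoszD -!(big_morph Posz PoszD (erefl _)).
  congr (_ + _)%R; rewrite (big_morph Posz PoszD (erefl _)); apply: eq_bigr => i' _.
  rewrite exchange_big /= (big_morph Posz PoszD (erefl _)); apply: eq_bigr => j' _.
  by rewrite (big_morph Posz PoszD (erefl _)).
have s0 : 'I_m by apply: (@Ordinal m 0); lia.
have t0 : 'I_n by apply: (@Ordinal n 0); lia.
(* Vertices that differ only in [s] share the last two sums of [HZ], so the first sums agree for
   every [j]. *)
have rs i s s' j : r i s j = r i s' j.
  apply/eqP; rewrite -subr_eq0; apply/eqP; move: j.
  apply: (@sum_neq_eq0 _ (fun j => r i s j - r i s' j)%R q1) => j.
  by have := HZ i s j t0; rewrite -(HZ i s' j t0) => /addIr/addIr; rewrite sumrB => ->; rewrite subrr.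
have lt i j t t' : l i j t = l i j t'.
  apply/eqP; rewrite -subr_eq0; apply/eqP; move: i.
  apply: (@sum_neq_eq0 _ (fun i => l i j t - l i j t')%R p1) => i.
  by have := HZ i s0 j t; rewrite -(HZ i s0 j t') => /addIr/addrI; rewrite sumrB => ->; rewrite subrr.
have rS i s j : (m%:Z * r i s j = S i j)%R.
  by rewrite /S (eq_bigr (fun=> r i s j)) // sum_int_const.
have lS i j t : (n%:Z * l i j t = S i j)%R.
  by rewrite SE (eq_bigr (fun=> l i j t)) // sum_int_const.
pose Z := block_weight p q m n.
(* The expected common block sum is [mnk / Z]; with the denominator cleared, the deviation from it
   solves the homogeneous system. *)
have SZ i j : (S i j * Z%:Z = m%:Z * n%:Z * k%:Z)%R.
  apply/eqP; rewrite -subr_eq0; apply/eqP; move: i j.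
  apply: (@block_system_eq0 p q m n (fun i j => S i j * Z%:Z - m%:Z * n%:Z * k%:Z)%R) => // i j.
  have cC (u : nat) (v : 'I_u) (w : int) : (\sum_(v' | v' != v) w = (u%:Z - 1) * w)%R.
    rewrite sumr_const cardC1 card_ord -mulr_natl natz; case: u v => [[]//|u] v; congr (_ * _)%R; lia.
  have D : (\sum_(i' | i' != i) \sum_(j' | j' != j) (S i' j' * Z%:Z - m%:Z * n%:Z * k%:Z)
      = (\sum_(i' | i' != i) \sum_(j' | j' != j) S i' j') * Z%:Z
        - (p%:Z - 1) * ((q%:Z - 1) * (m%:Z * n%:Z * k%:Z)))%R.
    rewrite mulr_suml -(cC _ i) -sumrB; apply: eq_bigr => i' _.
    by rewrite sumrB -mulr_suml cC.
  rewrite D !sumrB -!mulr_suml !cC.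
  have := HZ i s0 j t0.
  (* The factor [mn] turns line sums into block sums through [rS] and [lS]. *)
  move/(congr1 (fun x => m%:Z * n%:Z * x)%R); rewrite !mulrDr.
  have -> : (m%:Z * n%:Z * (\sum_(j' | j' != j) r i s0 j') = n%:Z * \sum_(j' | j' != j) S i j')%R.
    by rewrite -[in RHS](eq_bigr _ (fun j' _ => rS i s0 j')) -mulr_sumr; ring.
  have -> : (m%:Z * n%:Z * (\sum_(i' | i' != i) l i' j t0) = m%:Z * \sum_(i' | i' != i) S i' j)%R.
    by rewrite -[in RHS](eq_bigr _ (fun i' _ => lS i' j t0)) -mulr_sumr; ring.
  set u1 := (\sum_(j' | j' != j) S i j')%R; set u2 := (\sum_(i' | i' != i) S i' j)%R.
  set u3 := (\sum_(i' | i' != i) _)%R => HE.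
  have ZE : (Z%:Z = n%:Z * (q%:Z - 1) + m%:Z * (p%:Z - 1)
      + m%:Z * n%:Z * ((p%:Z - 1) * (q%:Z - 1)))%R.
    by rewrite /Z /block_weight !PoszD !PoszM !subzn ?(ltnW p1) ?(ltnW q1).
  transitivity ((n%:Z * u1 + m%:Z * u2 + m%:Z * n%:Z * u3) * Z%:Z - m%:Z * n%:Z * k%:Z * Z%:Z)%R.
    by rewrite ZE; ring.
  by rewrite HE subrr.
split=> [i s j|i j t]; apply/eqP; rewrite -eqz_nat !PoszM.
- have m0 : (m%:Z != 0)%R by lia.
  apply/eqP/(mulfI m0); rewrite mulrA -/(r i s j) rS SZ; ring.
- have n0 : (n%:Z != 0)%R by lia.
  apply/eqP/(mulfI n0); rewrite mulrA -/(l i j t) lS SZ; ring.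
Qed.

Lemma sum_iota1 N : 2 * \sum_(i <- iota 1 N) i = N * N.+1.
Proof.
elim: N => [|N IH]; first by rewrite big_nil.
have -> : iota 1 N.+1 = iota 1 N ++ [:: N.+1] by rewrite -{1}[N.+1]addn1 iotaD.
by rewrite big_cat mulnDr IH big_seq1; lia.
Qed.

Lemma sum_labels (T : finType) (f : T -> nat) :
  injective f -> (forall x, 1 <= f x <= #|T|) -> 2 * \sum_x f x = #|T| * #|T|.+1.
Proof.
move=> fi fb; rewrite -sum_iota1; congr (2 * _).
rewrite -big_enum -(big_map f xpredT id) /=; apply: perm_big.
have us : uniq (map f (enum T)) by rewrite map_inj_uniq ?enum_uniq.
have [] := @uniq_min_size _ (map f (enum T)) (iota 1 #|T|) us.
- by move=> y /mapP[x _ ->]; rewrite mem_iota add1n ltnS.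
- by rewrite size_iota size_map -cardE.
- by move=> _ mem; apply: uniq_perm => //; apply: iota_uniq.
Qed.

Lemma sum_prod (A B : finType) (F : A * B -> nat) :
  \sum_x F x = \sum_u \sum_v F (u, v).
Proof. by rewrite pair_bigA; apply: eq_bigr => -[]. Qed.

Lemma sum_neq_const (u : nat) (v : 'I_u) (w : nat) :
  \sum_(v' | v' != v) w = u.-1 * w.
Proof. by rewrite sum_nat_const cardC1 card_ord. Qed.

(** Adding the lines of one direction over the whole graph gives total times [Z] equal to [N * k].
    As the total is [N(N+1)/2], this determines [k] and hence the line sums, whose integrality is
    the conclusion. *)
Lemma distance_magic_line_sums a b m p q n :
  1 <= a -> 1 <= b -> 1 < m -> 1 < p -> 1 < q -> 2 < n ->
  distance_magic (strong_rel (union_rel a (Hrel m p)) (union_rel b (Hrel n q))) ->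
  ~~ odd (n * (m * n * a * b * p * q).+1) /\
  ~~ odd (m * (m * n * a * b * p * q).+1).
Proof.
move=> a0 b0 m1 p1 q1 n2 [f [finj fb [k fk]]].
pose N := m * n * a * b * p * q; rewrite -/N.
have N0 : 0 < N by rewrite /N !muln_gt0; lia.
pose Z := block_weight p q m n.
have Z0 : 0 < Z.
  by rewrite /Z /block_weight -addnA addn_gt0 muln_gt0 subn_gt0 q1 (ltnW (ltnW n2)).
have lines c d := line_sums_const (G := fun i s j t => f ((c, (i, s)), (d, (j, t))))
  p1 q1 m1 n2 (fun i s j t =>
    etrans (esym (nbr_sum_multipartite_product f c i s d j t)) (fk _)).
have sumf : 2 * \sum_x f x = N * N.+1.
  rewrite sum_labels // !card_prod !card_ord.
  by have -> : a * (p * m) * (b * (q * n)) = N by rewrite /N; ring.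
have sumZ : (\sum_x f x) * Z = N * k.
  rewrite sum_prod big_distrl /=.
  rewrite (eq_bigr (fun=> b * (q * (n * k)))) => [|[c [i s]] _].
    by rewrite sum_nat_const !card_prod !card_ord /N; ring.
  rewrite sum_prod big_distrl /= (eq_bigr (fun=> q * (n * k))) => [|d _].
    by rewrite sum_nat_const card_ord.
  rewrite sum_prod big_distrl /= (eq_bigr (fun=> n * k)) => [|j _].
    by rewrite sum_nat_const card_ord.
  exact: (lines c d).1.
have kZ : 2 * k = N.+1 * Z.
  apply/eqP; rewrite -(eqn_pmul2l N0) mulnA [N * 2]mulnC -mulnA -sumZ mulnA sumf.
  by rewrite -mulnA.
(* Here [u] is the sum of a line of [v] cells; cancelling [Z] leaves [2 * u = v * N.+1]. *)
have even_of u v : u * Z = v * k -> ~~ odd (v * N.+1).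
  move=> uv; suff -> : v * N.+1 = 2 * u by rewrite mul2n odd_double.
  apply/eqP; rewrite -(eqn_pmul2r Z0) -mulnA -kZ -mulnA uv; apply/eqP; ring.
pose o u (u0 : 0 < u) := Ordinal u0.
pose c := o a a0; pose d := o b b0; pose i := o p (ltnW p1); pose j := o q (ltnW q1).
split.
  exact: even_of ((lines c d).1 i (o m (ltnW m1)) j).
exact: even_of ((lines c d).2 i j (o n (ltnW (ltnW n2)))).
Qed.

(** * Sufficiency and the equivalence *)

(** Each block, given by a component and a part in both factors, receives the rectangle whose number
    is its [enum_rank]. Common line sums in both directions then fix all three terms of the
    neighbour sum. *)
Lemma distance_magic_of_rect a b m p q n :
  zero_rect m n (centered (m * n)) -> cperm_rect (a * p * (b * q)) m n ->
  distance_magic (strong_rel (union_rel a (Hrel m p)) (union_rel b (Hrel n q))).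
Proof.
pose I : finType := (('I_a * 'I_p) * ('I_b * 'I_q))%type.
have cardI : #|I| = a * p * (b * q) by rewrite !card_prod !card_ord.
rewrite -cardI => zr cr.
have [F [Finj Flt Frow Fcol]] := magic_rect_set zr cr.
set N := m * n * #|I| in Flt Frow Fcol.
pose f (x : ('I_a * Hvert m p) * ('I_b * Hvert n q)) : nat :=
  (F (enum_rank (((x.1.1, x.1.2.1), (x.2.1, x.2.2.1)) : I)) x.1.2.2 x.2.2.2).+1.
(* Raising the labels by one, to start at 1, adds [u] to a line of [u] cells. *)
have lineE u v (G : 'I_u -> nat) : 2 * \sum_i G i = v -> \sum_i (G i).+1 = v./2 + u.
  move=> <-; rewrite mul2n doubleK.
  by under eq_bigr do rewrite -addn1; rewrite big_split /= sum1_card card_ord.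
pose r := (n * (N - 1))./2 + n; pose l := (m * (N - 1))./2 + m.
have fr c i s d j : \sum_t f ((c, (i, s)), (d, (j, t))) = r.
  exact: lineE (Frow (enum_rank (((c, i), (d, j)) : I)) s).
have fl c i d j t : \sum_s f ((c, (i, s)), (d, (j, t))) = l.
  exact: lineE (Fcol (enum_rank (((c, i), (d, j)) : I)) t).
exists f; split.
- move=> [[c [i s]] [d [j t]]] [[c' [i' s']] [d' [j' t']]] [] /Finj[].
  by move=> /enum_rank_inj[-> -> -> ->] -> ->.
- move=> x; rewrite /f !card_prod !card_ord /=.
  have <- : N = a * (p * m) * (b * (q * n)) by rewrite /N cardI; ring.
  exact: Flt.
- exists (q.-1 * r + p.-1 * l + p.-1 * (m * (q.-1 * r))).
  move=> [[c [i s]] [d [j t]]]; rewrite nbr_sum_multipartite_product.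
  rewrite (eq_bigr _ (fun j' _ => fr c i s d j')) sum_neq_const.
  rewrite (eq_bigr _ (fun i' _ => fl c i' d j t)) sum_neq_const; congr (_ + _).
  rewrite (eq_bigr (fun=> m * (q.-1 * r))) ?sum_neq_const // => i' _.
  rewrite (eq_bigr (fun=> q.-1 * r)) ?sum_nat_const ?card_ord // => s' _.
  by rewrite (eq_bigr _ (fun j' _ => fr c i' s' d j')) sum_neq_const.
Qed.

Theorem theorem11 (a b m p q n : nat) :
  1 <= a -> 1 <= b -> 1 < m -> 1 < p -> 1 < q -> 4 <= n ->
  distance_magic (strong_rel (union_rel a (Hrel m p)) (union_rel b (Hrel n q)))
  <-> ((~~ odd m && ~~ odd n) \/ odd (m * n * a * b * p * q)).
Proof.
move=> a0 b0 m1 p1 q1 n4; split.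
  case/distance_magic_line_sums => //; first exact: ltnW.
  set N := _ * q; rewrite (oddM n) (oddM m) /=.
  by case: (odd N) => /=; [right|rewrite !andbT => -> ->; left].
case=> [/andP[em en]|].
  by apply: distance_magic_of_rect; [exact: zero_rect_even|exact: cperm_rect_even].
rewrite !oddM => /andP[/andP[/andP[/andP[/andP[om on] oa] ob] op] oq].
have m3 : 3 <= m by lia.
have n5 : 5 <= n by lia.
apply: distance_magic_of_rect; first exact: zero_rect_odd.
by apply: cperm_rect_odd; rewrite ?oddM ?oa ?op ?ob ?oq //; lia.
Qed.
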